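(* Let $a,b\in\mathbb{R}^n$ and let $Q\in\mathbb{R}^{n\times n}$ be positive semidefinite. The relaxation (OptPairs) of (QI) is at least as strong as the relaxation (OptPersp) and at least as strong as the relaxation (Shor), where these problems are as defined in the context.
   Context: A prime denotes transpose, $\langle Q,Y\rangle=\sum_{i,j}Q_{ij}Y_{ij}$, and $A\succeq0$ means symmetric positive semidefinite. (QI): $\min\{a'x+b'y+y'Qy:(x,y)\in\mathcal I_n\}$, $\mathcal I_n=\{(x,y)\in\{0,1\}^n\times\mathbb{R}^n_+: y_i(1-x_i)=0,\ i=1,\dots,n\}$. (OptPairs): minimize $a'x+b'y+\langle Q,Y\rangle$ over $x,y\in\mathbb{R}^n$ and symmetric $Y\in\mathbb{R}^{n\times n}$ subject to $Y-yy'\succeq0$; $(x_i,x_j,y_i,y_j,Y_{ii},Y_{ij},Y_{jj})\in\mathcal W$ for all $i<j$; $0\le x\le1$; $y\ge0$. Here $\mathcal W$ is the set of points $(x_1,x_2,y_1,y_2,Y_{11},Y_{12},Y_{22})$ for which there exists a symmetric $3\times3$ matrix $W\succeq 0$ with - $W_{12}=Y_{12}$; - $(Y_{11}-W_{11})(x_1-W_{33})\ge(y_1-W_{31})^2$, $W_{11}\le Y_{11}$, $W_{33}\le x_1$; - $(Y_{22}-W_{22})(x_2-W_{33})\ge(y_2-W_{32})^2$, $W_{22}\le Y_{22}$, $W_{33}\le x_2$; - $0\le W_{31}\le y_1$, $0\le W_{32}\le y_2$; - $W_{33}\ge x_1+x_2-1$. (OptPersp): minimize $a'x+b'y+\langle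 Q,Y\rangle$ over $x,y\in\mathbb{R}^n$ and symmetric $Y\in\mathbb{R}^{n\times n}$ subject to $Y-yy'\succeq0$; $y_i^2\le Y_{ii}x_i$ for $i=1,\dots,n$; $0\le x\le1$; $y\ge0$. (Shor): minimize $a'x+b'y+\sum_{i=1}^n\sum_{j=1}^nQ_{ij}Z_{ij}$ over $x,y\in\mathbb{R}^n$ and symmetric $Z\in\mathbb{R}^{2n\times2n}$ subject to $y_i=Z_{i,i+n}$ and $x_i=Z_{i+n,i+n}$ for $i=1,\dots,n$; $Z-\begin{pmatrix}y\\ x\end{pmatrix}\begin{pmatrix}y'&x'\end{pmatrix}\succeq0$; $0\le x\le1$; $y\ge0$. A relaxation A is at least as strong as a relaxation B if, for every instance $(a,b,Q)$, the optimal value (infimum) of A is at least that of B.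
   Formalization: The formal theorem assumes n ≥ 2: for n = 1 (OptPairs) has no pair constraints and the claim fails, e.g. a = 1, b = -1, Q = 1 gives (OptPairs) value at most -1/4, but (OptPersp) and (Shor) value 0. *)

(* Defs.v *)
From mathcomp Require Import all_boot all_order all_algebra.
From mathcomp Require Import boolp classical_sets reals constructive_ereal ereal.
Import Order.TTheory GRing.Theory Num.Theory.

Set Implicit Arguments.
Unset Strict Implicit.
Unset Printing Implicit Defensive.

Local Open Scope classical_set_scope.
Local Open Scope ring_scope.

Definition psd (R : realType) (m : nat) (A : 'M[R]_m) : Prop :=
  A^T = A /\ forall v : 'cV[R]_m, 0 <= (v^T *m A *m v) 0 0.

Definition frob (R : realType) (m : nat) (A B : 'M[R]_m) : R :=
  \sum_(i < m) \sum_(j < m) A i j * B i j.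

Definition dotv (R : realType) (m : nat) (u v : 'cV[R]_m) : R :=
  \sum_(i < m) u i 0 * v i 0.

(* The indices 1, 2, 3 of the 3 x 3 matrix W are the ordinals 0, 1, 2 : 'I_3,
   so W_33 is [W 2 2] and W_31 is [W 2 0]. *)
Definition calW (R : realType) (x1 x2 y1 y2 Y11 Y12 Y22 : R) : Prop :=
  exists W : 'M[R]_3,
    [/\ psd W,
        W 0 1 = Y12,
        [/\ (y1 - W 2 0) ^+ 2 <= (Y11 - W 0 0) * (x1 - W 2 2),
            W 0 0 <= Y11
          & W 2 2 <= x1],
        [/\ (y2 - W 2 1) ^+ 2 <= (Y22 - W 1 1) * (x2 - W 2 2),
            W 1 1 <= Y22
          & W 2 2 <= x2]
      & [/\ 0 <= W 2 0 <= y1, 0 <= W 2 1 <= y2 & x1 + x2 - 1 <= W 2 2]].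

Definition box (R : realType) (n : nat) (x y : 'cV[R]_n) : Prop :=
  (forall i, 0 <= x i 0 <= 1) /\ (forall i, 0 <= y i 0).

Definition optpairs_feasible (R : realType) (n : nat)
    (x y : 'cV[R]_n) (Y : 'M[R]_n) : Prop :=
  [/\ Y^T = Y,
      psd (Y - y *m y^T),
      (forall i j : 'I_n, (i < j)%N ->
         calW (x i 0) (x j 0) (y i 0) (y j 0) (Y i i) (Y i j) (Y j j))
    & box x y].

Definition optpersp_feasible (R : realType) (n : nat)
    (x y : 'cV[R]_n) (Y : 'M[R]_n) : Prop :=
  [/\ Y^T = Y,
      psd (Y - y *m y^T),
      (forall i : 'I_n, y i 0 ^+ 2 <= Y i i * x i 0)
    & box x y].

Definition shor_feasible (R : realType) (n : nat)
    (x y : 'cV[R]_n) (Z : 'M[R]_(n + n)) : Prop :=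
  [/\ Z^T = Z,
      (forall i : 'I_n, y i 0 = Z (lshift n i) (rshift n i)),
      (forall i : 'I_n, x i 0 = Z (rshift n i) (rshift n i)),
      psd (Z - col_mx y x *m row_mx y^T x^T)
    & box x y].

(* Optimal values are infima in the extended reals: -oo if the problem is
   unbounded below, +oo if it is infeasible. *)
Definition optpairs_value (R : realType) (n : nat)
    (a b : 'cV[R]_n) (Q : 'M[R]_n) : \bar R :=
  ereal_inf [set v | exists x y Y, optpairs_feasible x y Y /\
                       v = (dotv a x + dotv b y + frob Q Y)%:E].

Definition optpersp_value (R : realType) (n : nat)
    (a b : 'cV[R]_n) (Q : 'M[R]_n) : \bar R :=
  ereal_inf [set v | exists x y Y, optpersp_feasible x y Y /\
                       v = (dotv a x + dotv b y + frob Q Y)%:E].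

Definition shor_value (R : realType) (n : nat)
    (a b : 'cV[R]_n) (Q : 'M[R]_n) : \bar R :=
  ereal_inf [set v | exists x y Z, shor_feasible x y Z /\
    v = (dotv a x + dotv b y +
         \sum_(i < n) \sum_(j < n) Q i j * Z (lshift n i) (lshift n j))%:E].

(* Main.v *)
Require Import Defs.
From mathcomp Require Import all_boot all_order all_algebra.
From mathcomp Require Import boolp classical_sets reals constructive_ereal ereal.
From mathcomp Require Import ring lra.
Import Order.TTheory GRing.Theory Num.Theory.
Local Open Scope ring_scope.

(** The three relaxations form a chain, Shor below OptPersp below OptPairs, and
each step keeps [x], [y] and [Y], hence the objective value.

From OptPairs to OptPersp.  Fix an index [i] and choose a pair containing it.
The matrix [W] of the pair splits the vector [(Y_ii, x_i, y_i)] into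
[(W_kk, W_33, W_3k)] and the remainder.  The first satisfies
[W_3k ^ 2 <= W_kk W_33] because [W] is positive semidefinite
([psd_minor2]), and the second satisfies the same inequality by the definition
of the pairwise set.  The rotated cone [q ^ 2 <= a b], [a, b >= 0] is closed
under addition ([rotated_cone_add]), so [y_i ^ 2 <= Y_ii x_i].

From OptPersp to Shor.  One has to choose the unspecified entries of [Z], with
[Y] as its upper left block, so that [Z] minus the rank-one term is positive
semidefinite.  Put [S = Y - y y'].  The prescribed entries of the difference
are [S], the diagonal [c_i = y_i (1 - x_i)] of the off-diagonal block and the
diagonal [d_i = x_i (1 - x_i)] of the lower block, and the perspective
inequality gives [c_i ^ 2 <= S_ii d_i].  This is a chordal completion
problem: each new row is only tied to row [i] of [S], so it can be taken to
be [t_i = c_i / S_ii] times that row, plus an independent nonnegative diagonal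
term [d_i - t_i ^ 2 S_ii] ([psd_completion]). *)

(** * Positive semidefinite matrices *)

Lemma psdD (R : realType) (m : nat) (A B : 'M[R]_m) :
  psd A -> psd B -> psd (A + B).
Proof.
move=> [sA pA] [sB pB]; split; first by rewrite linearD /= sA sB.
by move=> v; rewrite mulmxDr mulmxDl mxE addr_ge0.
Qed.

Lemma psd_congr (R : realType) (m k : nat) (A : 'M[R]_m) (P : 'M[R]_(m, k)) :
  psd A -> psd (P^T *m A *m P).
Proof.
move=> [sA pA]; split; first by rewrite !trmx_mul trmxK sA mulmxA.
by move=> v; have := pA (P *m v); rewrite trmx_mul !mulmxA.
Qed.

Lemma psd_diag (R : realType) (m : nat) (e : 'rV[R]_m) :
  (forall i, 0 <= e 0 i) -> psd (diag_mx e).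
Proof.
move=> e_ge0; split; first exact: tr_diag_mx.
move=> v; rewrite mul_mx_diag mxE sumr_ge0 // => i _.
by rewrite !mxE mulrAC -expr2 mulr_ge0 ?sqr_ge0.
Qed.

Lemma quad_delta (R : realType) (m : nat) (A : 'M[R]_m) (i j : 'I_m) :
  (delta_mx i 0)^T *m A *m delta_mx j (0 : 'I_1) = (A i j)%:M.
Proof. by rewrite trmx_delta -rowE -colE; apply/rowP=> k; rewrite !ord1 !mxE. Qed.

Lemma psd_diag_ge0 (R : realType) (m : nat) (A : 'M[R]_m) (i : 'I_m) :
  psd A -> 0 <= A i i.
Proof.
by move=> [_ /(_ (delta_mx i 0))]; rewrite quad_delta mxE.
Qed.

(** Nonnegativity of the quadratic form on the plane spanned by two basis
vectors is a discriminant inequality. *)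
Lemma psd_minor2 (R : realType) (m : nat) (A : 'M[R]_m) (i j : 'I_m) :
  psd A -> A i j ^+ 2 <= A i i * A j j.
Proof.
move=> psdA; have [sA pA] := psdA.
have Ai_ge0 := psd_diag_ge0 _ _ _ i psdA.
have form s t : 0 <= s ^+ 2 * A i i + 2 * s * t * A i j + t ^+ 2 * A j j.
  have := pA (s *: delta_mx i 0 + t *: delta_mx j 0).
  rewrite [(_ + _)^T]linearD /= ![(_ *: _)^T]linearZ /= !(mulmxDl, mulmxDr).
  rewrite -!(scalemxAl, scalemxAr).
  rewrite !quad_delta.
  have -> : A j i = A i j by rewrite -{1}sA mxE.
  by rewrite !mxE /= !mulr1n => H; nra.
have [Ai0|Ai_neq0] := eqVneq (A i i) 0.
  (* With [A i i = 0] the form is affine in [s], so it can stay nonnegative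
     only if its slope vanishes: these [s], [t] give [- 4 A_ij ^ 2]. *)
  have := form (- (A j j + 1)) (2 * A i j); rewrite Ai0; nra.
have Ai_gt0 : 0 < A i i by rewrite lt_def Ai_neq0.
have := form (A i j) (- A i i).
rewrite (_ : _ + _ = A i i * (A i i * A j j - A i j ^+ 2)); last ring.
by rewrite pmulr_rge0 // subr_ge0.
Qed.

(** * From the pairwise relaxation to the perspective relaxation *)

(** Given the two hypotheses, the claim reduces to [2 p q <= a d + c b], which follows from
[(p q) ^ 2 <= (a d) (c b)] by the inequality of arithmetic and geometric
means. *)
Lemma rotated_cone_add (R : realType) (a b c d p q : R) :
  0 <= a -> 0 <= b -> 0 <= c -> 0 <= d ->
  p ^+ 2 <= a * b -> q ^+ 2 <= c * d ->
  (p + q) ^+ 2 <= (a + c) * (b + d).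
Proof.
move=> a0 b0 c0 d0 hp hq.
have hpq : p ^+ 2 * q ^+ 2 <= (a * b) * (c * d).
  by rewrite ler_pM ?sqr_ge0.
have ad0 : 0 <= a * d by rewrite mulr_ge0.
have cb0 : 0 <= c * b by rewrite mulr_ge0.
have cross : 2 * (p * q) <= a * d + c * b.
  rewrite (le_trans (ler_norm _)) // -ler_sqr ?nnegrE ?addr_ge0 //.
  rewrite real_normK ?num_real //.
  have := sqr_ge0 (a * d - c * b); nra.
nra.
Qed.

Lemma persp_of_psd_split (R : realType) (m : nat) (W : 'M[R]_m) (k l : 'I_m)
    (x y Y : R) :
  psd W -> (y - W l k) ^+ 2 <= (Y - W k k) * (x - W l l) ->
  W k k <= Y -> W l l <= x -> y ^+ 2 <= Y * x.
Proof.
move=> psdW hrem hY hx.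
have hW : W l k ^+ 2 <= W k k * W l l by rewrite mulrC psd_minor2.
have := rotated_cone_add _ _ _ _ _ _ _ (psd_diag_ge0 _ _ _ k psdW)
  (psd_diag_ge0 _ _ _ l psdW) _ _ hW hrem.
by rewrite !subr_ge0 ![_ + (_ - _)]addrC !subrK; apply.
Qed.

Lemma calW_persp (R : realType) (x1 x2 y1 y2 Y11 Y12 Y22 : R) :
  calW x1 x2 y1 y2 Y11 Y12 Y22 ->
  y1 ^+ 2 <= Y11 * x1 /\ y2 ^+ 2 <= Y22 * x2.
Proof.
move=> [W [psdW _ [h1 hY1 hx1] [h2 hY2 hx2] _]].
by split; [apply: persp_of_psd_split h1 _ _ | apply: persp_of_psd_split h2 _ _].
Qed.

Lemma optpairs_optpersp_feasible (R : realType) (n : nat)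
    (x y : 'cV[R]_n) (Y : 'M[R]_n) :
  (2 <= n)%N -> optpairs_feasible x y Y -> optpersp_feasible x y Y.
Proof.
move=> n_ge2 [sY psdY hW hbox]; split=> // i.
have [j j_neq_i] : exists j : 'I_n, j != i.
  have : (0 < #|predC1 i|)%N by rewrite cardC1 card_ord -ltnS prednK // ltnW.
  by case/card_gt0P=> j; exists j.
have [lt_ij|lt_ji|/val_inj eq_ij] := ltngtP i j.
- by have [] := calW_persp _ _ _ _ _ _ _ _ (hW i j lt_ij).
- by have [] := calW_persp _ _ _ _ _ _ _ _ (hW j i lt_ji).
- by rewrite eq_ij eqxx in j_neq_i.
Qed.

(** * From the perspective relaxation to the Shor relaxation *)

(** The completion is [P' S P + diag (0, e)] with [P = (1 T)] and [T] the
diagonal matrix of the [t_i = c_i / S_ii].  When [S_ii = 0] the hypothesis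
forces [c_i = 0], so the convention [c_i / 0 = 0] is the right choice. *)
Lemma psd_completion (R : realType) (n : nat) (S : 'M[R]_n) (c d : 'I_n -> R) :
  psd S -> (forall i, 0 <= d i) -> (forall i, c i ^+ 2 <= S i i * d i) ->
  exists M : 'M[R]_(n + n),
    [/\ psd M, ulsubmx M = S, forall i, ursubmx M i i = c i
      & forall i, drsubmx M i i = d i].
Proof.
move=> psdS d_ge0 hcd.
pose t i := c i / S i i.
have St i : S i i * t i = c i.
  have [Si0|Si_neq0] := eqVneq (S i i) 0; last by rewrite mulrC divfK.
  have := hcd i; rewrite Si0 !mul0r => c2_le0.
  by apply/esym/eqP; rewrite -sqrf_eq0 eq_le c2_le0 sqr_ge0.
have e_ge0 i : 0 <= d i - t i * c i.
  have [Si0|Si_neq0] := eqVneq (S i i) 0.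
    by rewrite /t Si0 invr0 mulr0 mul0r subr0.
  have Si_gt0 : 0 < S i i by rewrite lt_def Si_neq0 psd_diag_ge0.
  by rewrite subr_ge0 /t mulrAC -expr2 ler_pdivrMr // mulrC.
pose T := diag_mx (\row_i t i).
pose E := diag_mx (\row_i (d i - t i * c i)).
pose P := row_mx 1%:M T.
pose D := row_mx (0 : 'M[R]_n) 1%:M.
have blocks : P^T *m S *m P + D^T *m E *m D =
    block_mx S (S *m T) (T *m S) (T *m S *m T + E).
  rewrite /P /D !tr_row_mx [_ *m S]mul_col_mx [_ *m E]mul_col_mx !mul_col_row.
  rewrite tr_diag_mx !trmx1 trmx0.
  by rewrite !(mul1mx, mulmx1, mul0mx, mulmx0) add_block_mx !addr0.
exists (P^T *m S *m P + D^T *m E *m D); split.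
- apply: psdD; apply: psd_congr => //.
  by apply: psd_diag => i; rewrite mxE.
- by rewrite blocks block_mxKul.
- by move=> i; rewrite blocks block_mxKur mul_mx_diag !mxE St.
- move=> i; rewrite blocks block_mxKdr mul_mx_diag mul_diag_mx !mxE eqxx mulr1n.
  by rewrite -mulrA St addrC subrK.
Qed.

Lemma optpersp_shor_feasible (R : realType) (n : nat)
    (x y : 'cV[R]_n) (Y : 'M[R]_n) :
  optpersp_feasible x y Y ->
  exists2 Z, shor_feasible x y Z & ulsubmx Z = Y.
Proof.
move=> [_ psdS persp [hx hy]].
pose c i := y i 0 * (1 - x i 0).
pose d i := x i 0 * (1 - x i 0).
have d_ge0 i : 0 <= d i.
  by have /andP[x0 x1] := hx i; rewrite mulr_ge0 ?subr_ge0.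
have hcd i : c i ^+ 2 <= (Y - y *m y^T) i i * d i.
  have /andP[_ x1] := hx i.
  have -> : (Y - y *m y^T) i i = Y i i - y i 0 ^+ 2.
    by rewrite !mxE big_ord1 !mxE.
  (* The difference of the two sides is [(1 - x_i) (Y_ii x_i - y_i ^ 2)]. *)
  rewrite -subr_ge0.
  rewrite (_ : _ - _ = (1 - x i 0) * (Y i i * x i 0 - y i 0 ^+ 2)).
    by rewrite mulr_ge0 ?subr_ge0.
  by rewrite /c /d; ring.
have [M [psdM Mul Mur Mdr]] := psd_completion _ _ _ _ _ psdS d_ge0 hcd.
pose r := col_mx y x *m row_mx y^T x^T.
have rE : r = block_mx (y *m y^T) (y *m x^T) (x *m y^T) (x *m x^T).
  exact: mul_col_row.
have sr : r^T = r by rewrite /r trmx_mul tr_col_mx tr_row_mx !trmxK.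
exists (M + r); last first.
  by rewrite -[M]submxK Mul rE add_block_mx block_mxKul subrK.
split=> //.
- by rewrite linearD /= sr; case: psdM => ->.
- move=> i; rewrite mxE rE block_mxEur !mxE big_ord1 !mxE.
  by have := Mur i; rewrite !mxE => ->; rewrite /c; ring.
- move=> i; rewrite mxE rE block_mxEdr !mxE big_ord1 !mxE.
  by have := Mdr i; rewrite !mxE => ->; rewrite /d; ring.
- by rewrite -/r addrK.
Qed.

(** * Comparison of the optimal values *)

Lemma optpersp_le_optpairs (R : realType) (n : nat) (a b : 'cV[R]_n)
    (Q : 'M[R]_n) :
  (2 <= n)%N -> (optpersp_value a b Q <= optpairs_value a b Q)%E.
Proof.
move=> n_ge2; apply: ereal_inf_le_tmp => _ [x [y [Y [feas ->]]]].
by exists x, y, Y; split=> //; apply: optpairs_optpersp_feasible.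
Qed.

Lemma shor_le_optpersp (R : realType) (n : nat) (a b : 'cV[R]_n)
    (Q : 'M[R]_n) :
  (shor_value a b Q <= optpersp_value a b Q)%E.
Proof.
apply: ereal_inf_le_tmp => _ [x [y [Y [feas ->]]]].
have [Z shorZ ZY] := optpersp_shor_feasible _ _ _ _ _ feas.
exists x, y, Z; split=> //; rewrite /frob -ZY.
by congr (_ + _)%:E; apply: eq_bigr => i _; apply: eq_bigr => j _; rewrite !mxE.
Qed.

Theorem proposition6 (R : realType) (n : nat) (hn : (2 <= n)%N)
    (a b : 'cV[R]_n) (Q : 'M[R]_n) (hQ : psd Q) :
  (optpersp_value a b Q <= optpairs_value a b Q)%E /\
  (shor_value a b Q <= optpairs_value a b Q)%E.
Proof.
split; first exact: optpersp_le_optpairs.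
exact: le_trans (shor_le_optpersp _ _ a b Q) (optpersp_le_optpairs _ _ a b Q hn).
Qed.
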